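(* For each integer $n\ge1$ define, for $x\in[0,1]$, $\varphi_n(x):=\dfrac{e^{x/n}-1}{e^{1/n}-1}$ and, for $f\in C[0,1]$, $$\mathcal{B}_nf(x):=\sum_{k=0}^n f\!\left(\frac kn\right)\binom nk\,\varphi_n(x)^k\,(1-\varphi_n(x))^{n-k}.$$ Then $\mathcal{B}_n$ is a generalized Bernstein operator from $C[0,1]$ into the extended Chebyshev space $U_n:=\operatorname{Span}\{e^{jx/n}:j=0,\dots,n\}$ over $[0,1]$ (with the strictly increasing, equidistributed nodes $k/n$), fixing $f_0(x)=1$ and $f_1(x)=e^x$. Moreover: (i) the operators $\mathcal{B}_n$ converge strongly to the identity, i.e. for every $f\in C[0,1]$, $\mathcal{B}_nf\to f$ uniformly on $[0,1]$ as $n\to\infty$; (ii) each $\mathcal{B}_n$ preserves $(1,e^x)$-convexity, i.e. if $f\in C[0,1]$ is $(1,e^x)$-convex then so is $\mathcal{B}_nf$; (iii) no $\mathcal{B}_n$ preserves ordinary convexity, i.e. for each $n\ge 1$ there is a convex $f\in C[0,1]$ such that $\mathcal{B}_nf$ is not convex.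
   Context: All functions are real-valued. Extended Chebyshev space: an extended Chebyshev space $U_n$ of dimension $n+1$ over $[a,b]$ is an $(n+1)$-dimensional linear subspace of $C^n([a,b])$ such that each $f\in U_n$ not vanishing identically has at most $n$ zeros in $[a,b]$, counting multiplicities. Non-negative Bernstein basis: a collection of non-negative functions $p_{n,k}\in U_n$, $k=0,\dots,n$, such that each $p_{n,k}$ has a zero of order (exactly) $k$ at $a$ and a zero of order (exactly) $n-k$ at $b$. Generalized Bernstein operator fixing $f_0,f_1$ (where $f_0,f_1\in U_n$, $f_0>0$, $f_1/f_0$ strictly increasing): an operator $\mathcal{B}_n:C[a,b]\to U_n$ of the form $\mathcal{B}_n(f)=\sum_{k=0}^n f(t_{n,k})\alpha_{n,k}p_{n,k}$ with nodes $t_{n,k}\in[a,b]$, $t_{n,0}=a$, $t_{n,n}=b$, weights $\alpha_{n,k}>0$, and $(p_{n,k})$ a non-negative Bernstein basis of $U_n$, such that $\mathcal{B}_nf_0=f_0$ and $\mathcal{B}_nf_1=f_1$. $(f_0,f_1)$-convexity: $\phi$ is $(f_0,f_1)$-convex on $[a,b]$ if for all $x<y$ in $[a,b]$, the unique $h\in\operatorname{Span}\{f_0,f_1\}$ with $h(x)=\phi(x)$ and $h(y)=\phi(y)$ satisfies $\phi\le h$ on $[x,y]$. Ordinary convexity is $(1,x)$-convexity; $(1,e^x)$-convexity is the case $f_0(x)=1$, $f_1(x)=e^x$. *)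

(* Defs.v *)
From mathcomp Require Import all_boot all_order all_algebra.
From mathcomp Require Import all_classical all_reals all_analysis.
From mathcomp Require Import ring.
Import Order.TTheory GRing.Theory Num.Theory.
Import numFieldNormedType.Exports.

Set Implicit Arguments.
Unset Strict Implicit.
Unset Printing Implicit Defensive.

Local Open Scope classical_set_scope.
Local Open Scope ring_scope.

(* A real function on [a, b] is represented by a total function R -> R whose
   values outside [a, b] are irrelevant: every notion below depends only on
   the restriction to [a, b], and sets of functions are closed under changing
   a function outside [a, b]. *)

Section FunctionsOnInterval.
Context {R : realType}.
Implicit Types (a b x : R) (f g : R -> R) (n k : nat).

Definition Cab a b : set (R -> R) :=
  [set f | {within `[a, b], continuous f}].

(* The point y tends to x inside [a, b], so derivatives at the end points are
   one-sided. *)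
Definition diff_quot f x : R -> R := fun y => (f y - f x) / (y - x).

Definition deriv_in a b f : R -> R :=
  fun x => lim (diff_quot f x @ within `[a, b] x^').

Definition nderiv_in a b k f : R -> R := iter k (deriv_in a b) f.

Definition Cnab a b n : set (R -> R) :=
  [set f | (forall k, (k < n)%N -> forall x, x \in `[a, b] ->
              cvg (diff_quot (nderiv_in a b k f) x @ within `[a, b] x^')) /\
           (forall k, (k <= n)%N -> Cab a b (nderiv_in a b k f))].

(* Order of x as a zero of f: the least k <= n with nonzero k-th derivative
   at x, or n + 1 if f and its first n derivatives all vanish at x.  For f of
   class C^n only these derivatives are available.  The order is 0 when x is
   not a zero. *)
Definition zero_order a b n f x : nat :=
  find (fun k => nderiv_in a b k f x != 0) (iota 0 n.+1).

Definition span_on a b n (e : 'I_n -> R -> R) : set (R -> R) :=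
  [set f | exists c : 'I_n -> R,
     {in `[a, b], forall x, f x = \sum_(i < n) c i * e i x}].

Definition free_on a b n (e : 'I_n -> R -> R) : Prop :=
  forall c : 'I_n -> R,
    {in `[a, b], forall x, \sum_(i < n) c i * e i x = 0} -> forall i, c i = 0.

Definition ext_chebyshev a b n (U : set (R -> R)) : Prop :=
  [/\ a < b,
      exists e : 'I_n.+1 -> R -> R, free_on a b e /\ U = span_on a b e,
      U `<=` Cnab a b n
    & forall f, U f -> (exists2 x, x \in `[a, b] & f x != 0) ->
        forall s : seq R, uniq s -> {subset s <= `[a, b]} ->
          (\sum_(x <- s) zero_order a b n f x <= n)%N].

Definition nonneg_bernstein_basis a b n (U : set (R -> R))
    (p : 'I_n.+1 -> R -> R) : Prop :=
  forall k : 'I_n.+1,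
    [/\ U (p k),
        {in `[a, b], forall x, 0 <= p k x},
        zero_order a b n (p k) a = k
      & zero_order a b n (p k) b = (n - k)%N].

Definition gen_bernstein_operator a b n (U : set (R -> R)) (f0 f1 : R -> R)
    (t : 'I_n.+1 -> R) (B : (R -> R) -> R -> R) : Prop :=
  [/\ ext_chebyshev a b n U,
      [/\ U f0, U f1, {in `[a, b], forall x, 0 < f0 x}
        & {in `[a, b] &, forall x y, x < y -> f1 x / f0 x < f1 y / f0 y}],
      [/\ forall k : 'I_n.+1, t k \in `[a, b], t ord0 = a & t ord_max = b],
      exists (alpha : 'I_n.+1 -> R) (p : 'I_n.+1 -> R -> R),
        [/\ forall k : 'I_n.+1, 0 < alpha k,
            nonneg_bernstein_basis a b U p
          & forall f, Cab a b f -> U (B f) /\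
              {in `[a, b], forall x,
                 B f x = \sum_(k < n.+1) f (t k) * alpha k * p k x}]
    & {in `[a, b], B f0 =1 f0} /\ {in `[a, b], B f1 =1 f1}].

(* When f0 > 0 and f1 / f0 is strictly increasing on [a, b], the interpolant
   quantified over in [gconvex] exists and is unique. *)
Lemma interpolant_unique a b f0 f1 (f0_gt0 : {in `[a, b], forall x, 0 < f0 x})
    (f1_incr : {in `[a, b] &, forall x y, x < y -> f1 x / f0 x < f1 y / f0 y})
    x y (xab : x \in `[a, b]) (yab : y \in `[a, b]) (xy : x < y) (u v : R) :
  exists! c : R * R, c.1 * f0 x + c.2 * f1 x = u /\ c.1 * f0 y + c.2 * f1 y = v.
Proof.
have fx := f0_gt0 _ xab; have fy := f0_gt0 _ yab.
have := f1_incr _ _ xab yab xy; rewrite ltr_pdivrMr// mulrAC ltr_pdivlMr// => h.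
have d0 : f1 y * f0 x - f1 x * f0 y != 0 by rewrite subr_eq0 gt_eqF.
exists ((u * f1 y - v * f1 x) / (f1 y * f0 x - f1 x * f0 y),
        (v * f0 x - u * f0 y) / (f1 y * f0 x - f1 x * f0 y)); split => /=.
  by split; field.
by case=> c d /= [<- <-]; congr (_, _); field.
Qed.

Definition gconvex a b f0 f1 (phi : R -> R) : Prop :=
  {in `[a, b] &, forall x y, x < y -> forall c0 c1 : R,
     c0 * f0 x + c1 * f1 x = phi x -> c0 * f0 y + c1 * f1 y = phi y ->
     {in `[x, y], forall z, phi z <= c0 * f0 z + c1 * f1 z}}.

Definition convex_on a b (phi : R -> R) : Prop := gconvex a b (fun=> 1) id phi.

Definition exp_space n : set (R -> R) :=
  span_on 0 1 (fun (j : 'I_n.+1) (x : R) => expR (j%:R * x / n%:R)).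

Definition varphi n x : R :=
  (expR (x / n%:R) - 1) / (expR (1 / n%:R) - 1).

Definition exp_bernstein n f : R -> R := fun x =>
  \sum_(k < n.+1)
    f (k%:R / n%:R) * 'C(n, k)%:R * varphi n x ^+ k * (1 - varphi n x) ^+ (n - k).

End FunctionsOnInterval.

(* Main.v *)
Require Import Defs.
From mathcomp Require Import all_boot all_order all_algebra.
From mathcomp Require Import all_classical all_reals all_analysis.
From mathcomp Require Import ring lra.
Import Order.TTheory GRing.Theory Num.Theory.
Import numFieldNormedType.Exports.

(** Write [q = e^(1/n)].  The operator is the classical Bernstein operator of
    the values [f (k/n)], evaluated at [varphi n x]; since
    [1 - varphi + q varphi = e^(x/n)], it reproduces [q^k = e^(k/n)], that is,
    [expR].

    - Under [s = e^(x/n)] the space [U_n] becomes the polynomials of degree at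
      most [n], and differentiation becomes [p |-> s p' / n], so that for
      [s <> 0] orders of zeros are multiplicities of polynomial roots.
    - Convergence follows from Chebyshev's variance argument and
      [|varphi n x - x| <= 1/n].
    - The derivative of [B f] with respect to [expR] is, up to a positive
      factor, a Bernstein polynomial of degree [n - 1] with coefficients
      [(f ((k+1)/n) - f (k/n)) / q^k] evaluated at the increasing function
      [q varphi / (1 - varphi + q varphi)].  The [(1, e^x)]-convexity of [f] at
      three consecutive nodes says that these coefficients are nondecreasing,
      hence so is the derivative.
    - [B (- x) = - varphi], which is strictly concave. *)

Set Implicit Arguments.
Unset Strict Implicit.
Unset Printing Implicit Defensive.

Local Open Scope classical_set_scope.
Local Open Scope ring_scope.

(** * Bernstein polynomials through de Casteljau's recursion *)

Section Casteljau.
Context {R : realType}.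
Implicit Types (r s : nat -> R) (t q : R) (m k : nat).

(** De Casteljau's algorithm for the Bernstein polynomial of degree [m] with coefficients
    [r 0, ..., r m]. In this form linearity, monotonicity and the derivative all follow by induction
    on [m]. *)
Fixpoint casteljau m r t : R :=
  if m is m'.+1
  then (1 - t) * casteljau m' r t + t * casteljau m' (r \o succn) t
  else r 0%N.

Lemma casteljauE m r t :
  \sum_(k < m.+1) r k * 'C(m, k)%:R * t ^+ k * (1 - t) ^+ (m - k) =
  casteljau m r t.
Proof.
elim: m r => [|m IH] r; first by rewrite big_ord1 bin0 !expr0 !mulr1.
rewrite /= -!IH !mulr_sumr big_ord_recl /= bin0.
under eq_bigr => i _ do
  rewrite /bump /= add1n binS natrD subSS !mulrDr 2!mulrDl.
rewrite big_split /= addrA; congr (_ + _); last first.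
  by apply: eq_bigr => i _; rewrite exprS; ring.
rewrite [RHS]big_ord_recl /= bin0 big_ord_recr /= bin_small// mulr0 !mul0r addr0.
rewrite !subn0 exprS; congr (_ + _); first by ring.
apply: eq_bigr => i _; rewrite /bump /= add1n.
have [im|mi] := ltnP i m; first by rewrite -(subnSK im) [(1 - t) ^+ _.+1]exprS; ring.
by rewrite bin_small// mulr0 !mul0r mulr0.
Qed.

Lemma eq_casteljau m r s t : (forall k, (k <= m)%N -> r k = s k) ->
  casteljau m r t = casteljau m s t.
Proof.
elim: m r s => [|m IH] r s rs /=; first exact: rs.
congr (_ * _ + _ * _); apply: IH => k km; apply: rs => //.
exact: leq_trans km _.
Qed.

Lemma casteljau_linear m r s a b t :
  casteljau m (fun k => a * r k + b * s k) t =
  a * casteljau m r t + b * casteljau m s t.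
Proof.
elim: m r s => [//|m IH] r s /=; rewrite IH.
rewrite -[_ \o succn]/(fun k => a * (r \o succn) k + b * (s \o succn) k) IH.
by ring.
Qed.

Lemma casteljau_cst m a t : casteljau m (fun=> a) t = a.
Proof. by elim: m => [//|m IH] /=; rewrite -[_ \o _]/(fun=> a) IH; ring. Qed.

(** A projective change of parameter: with [w = 1 - t + q * t] and [u = q * t / w] one has
    [1 - t = w * (1 - u)] and [q * t = w * u], so each level of the recursion releases one factor
    [w]. *)
Lemma casteljau_tilt m r q t : 1 - t + q * t != 0 ->
  casteljau m (fun k => r k * q ^+ k) t =
  (1 - t + q * t) ^+ m * casteljau m r (q * t / (1 - t + q * t)).
Proof.
move=> w0; elim: m r => [|m IH] r /=; first by rewrite !mulr1 mul1r.
(* The dummy summand [0 * 0] brings the sequence into the two-term shape of [casteljau_linear]; the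
   same device recurs below. *)
have -> : casteljau m ((fun k => r k * q ^+ k) \o succn) t =
    casteljau m (fun k => q * ((r \o succn) k * q ^+ k) + 0 * 0) t.
  by apply: eq_casteljau => k _ /=; rewrite exprS; ring.
by rewrite (casteljau_linear _ _ (fun=> 0)) !IH exprS; field.
Qed.

Lemma casteljau_exp m q t : 1 - t + q * t != 0 ->
  casteljau m (fun k => q ^+ k) t = (1 - t + q * t) ^+ m.
Proof.
move=> w0; rewrite -(@eq_casteljau _ (fun k => 1 * q ^+ k)).
  by rewrite casteljau_tilt// casteljau_cst mulr1.
by move=> k _; rewrite mul1r.
Qed.

Lemma casteljau_id m t : casteljau m (fun k => k%:R) t = m%:R * t.
Proof.
elim: m => [|m IH] /=; first by rewrite mul0r.
rewrite (@eq_casteljau _ (_ \o _) (fun k => 1 * k%:R + 1 * 1)).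
  by rewrite (casteljau_linear _ _ (fun=> 1)) IH casteljau_cst -(@natr1 _ m); ring.
by move=> k _ /=; rewrite -(@natr1 _ k); ring.
Qed.

(** Second moment of the binomial law: the variance plus the square of the mean. *)
Lemma casteljau_sqr m t :
  casteljau m (fun k => k%:R ^+ 2) t = m%:R * t * (1 - t) + (m%:R * t) ^+ 2.
Proof.
elim: m => [|m IH] /=; first by rewrite mulr0n; ring.
rewrite (@eq_casteljau _ (_ \o _)
  (fun k => 1 * k%:R ^+ 2 + 1 * (2 * k%:R + 1 * 1))).
  rewrite casteljau_linear (casteljau_linear _ _ (fun=> 1)).
  by rewrite IH casteljau_cst casteljau_id -(@natr1 _ m); ring.
by move=> k _ /=; rewrite -(@natr1 _ k); ring.
Qed.

Lemma ler_casteljau m r s t : 0 <= t <= 1 ->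
  (forall k, (k <= m)%N -> r k <= s k) -> casteljau m r t <= casteljau m s t.
Proof.
move=> /andP[t0 t1]; elim: m r s => [|m IH] r s rs /=; first exact: rs.
apply: lerD; apply: ler_wpM2l; rewrite ?subr_ge0//; apply: IH => k km.
  by apply: rs; exact: leq_trans km _.
exact: rs.
Qed.

(** Both halves of the recursion grow with the parameter by induction, and the shifted half
    dominates the other one, so moving weight onto it raises the value further. *)
Lemma casteljau_nondecreasing m r t u : 0 <= t -> t <= u -> u <= 1 ->
  (forall k, (k < m)%N -> r k <= r k.+1) -> casteljau m r t <= casteljau m r u.
Proof.
move=> t0 tu u1; elim: m r => [//|m IH] r rr /=.
have h1 := IH r (fun k km => rr k (leq_trans km (leqnSn _))).
have h2 := IH (r \o succn) (fun k km => rr k.+1 km).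
have h3 : casteljau m r u <= casteljau m (r \o succn) u.
  by apply: ler_casteljau => //; rewrite u1 (le_trans t0 tu).
by nra.
Qed.

Lemma is_derive_casteljau m r t : is_derive t 1 (casteljau m r)
  (m%:R * casteljau m.-1 (fun k => r k.+1 - r k) t).
Proof.
elim: m r => [|m IH] r.
  by rewrite mul0r; exact: is_derive_cst.
have h1 := IH r; have h2 := IH (r \o succn).
rewrite /=; apply: is_derive_eq.
rewrite /GRing.scale /=.
(* Forward differences commute with the recursion, which turns every term of the differentiated
   recursion into values of [casteljau]. *)
have E k (u : nat -> R) : casteljau k (fun j => u j.+1 - u j) t =
    casteljau k (u \o succn) t - casteljau k u t.
  rewrite -[X in X - _]mul1r -mulN1r -casteljau_linear.
  by apply: eq_casteljau => j _ /=; ring.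
(* For [m = 0] the truncated [m.-1] is harmless because its coefficient is 0; otherwise the
   recursion unfolds once more. *)
rewrite !E; case: m {IH h1 h2} => [|m] /=; first by ring.
rewrite -(@natr1 _ m.+1); ring.
Qed.

End Casteljau.

(** * Derivatives and orders of zeros inside a closed interval *)

Section DerivativeOnInterval.
Context {R : realType}.
Implicit Types (a b x : R) (f g : R -> R).

(** Properness makes the limit in [deriv_in] unique. Nearby points of the interval are found to the
    right of [x] when [x < b], and to the left otherwise. *)
Lemma within_itv_dnbhs_proper a b x : a < b -> x \in `[a, b] ->
  ProperFilter (within `[a, b] x^').
Proof.
move=> ab; rewrite in_itv /= => /andP[ax xb]; split; last exact: within_filter.
rewrite /within /= => -[e /= e0 he].
have [xlb|bx] := ltP x b.
  pose y := Num.min b (x + e / 2).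
  have xy : x < y by rewrite lt_min xlb /=; lra.
  have yb : y <= b by rewrite ge_min lexx.
  have ye : y <= x + e / 2 by rewrite ge_min lexx orbT.
  apply: (he y) => /=; last 2 first.
  - by rewrite gt_eqF.
  - by rewrite in_itv /= yb andbT (le_trans ax (ltW xy)).
  by rewrite /ball_/= ltr_distl; apply/andP; split; lra.
pose y := Num.max a (x - e / 2).
have yx : y < x by rewrite gt_max (lt_le_trans ab bx)/=; lra.
have ay : a <= y by rewrite le_max lexx.
have ye : x - e / 2 <= y by rewrite le_max lexx orbT.
apply: (he y) => /=; last 2 first.
- by rewrite lt_eqF.
- by rewrite in_itv /= ay /= (le_trans (ltW yx) xb).
by rewrite /ball_/= ltr_distl; apply/andP; split; lra.
Qed.

(** Reduces derivatives within the interval, one-sided at its ends, to the ordinary derivative of a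
    function [g] on the line that agrees with [f] there. *)
Lemma cvg_diff_quot a b f g x l : {in `[a, b], f =1 g} -> x \in `[a, b] ->
  is_derive x 1 g l -> diff_quot f x @ within `[a, b] x^' --> l.
Proof.
move=> fg xab dg.
have dgl : h^-1 *: ((g \o shift x) (h *: 1) - g x) @[h --> 0^'] --> l.
  by rewrite -(@derive_val _ _ _ _ _ _ _ dg); exact: (@ex_derive _ _ _ _ _ _ _ dg).
apply/cvgrPdist_lt => e e0.
move/cvgrPdist_lt : dgl => /(_ e e0) [d /= d0 hd].
exists d => //= y /= xyd yx yab.
rewrite /diff_quot fg// fg//.
have := hd (y - x); rewrite /ball_ /= sub0r normrN distrC => /(_ xyd).
rewrite subr_eq0 => /(_ yx).
by rewrite /GRing.scale /= mulr1 subrK mulrC.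
Qed.

Lemma deriv_inE a b f g x l : a < b -> {in `[a, b], f =1 g} ->
  x \in `[a, b] -> is_derive x 1 g l -> deriv_in a b f x = l.
Proof.
move=> ab fg xab dg; apply: cvg_lim; first exact: norm_hausdorff.
  exact: within_itv_dnbhs_proper.
exact: cvg_diff_quot dg.
Qed.

Lemma nderiv_inE a b f (g : nat -> R -> R) k : a < b ->
  {in `[a, b], f =1 g 0%N} ->
  (forall i x, x \in `[a, b] -> is_derive x 1 (g i) (g i.+1 x)) ->
  {in `[a, b], nderiv_in a b k f =1 g k}.
Proof.
move=> ab fg dg; elim: k => [//|k IH] x xab.
exact: (deriv_inE ab IH xab (dg k x xab)).
Qed.

Lemma zero_orderE a b n f x m : (m <= n)%N ->
  (forall k, (k < m)%N -> nderiv_in a b k f x = 0) ->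
  nderiv_in a b m f x != 0 -> zero_order a b n f x = m.
Proof.
move=> mn km fm; rewrite /zero_order.
rewrite -(subnKC (leqW mn)) iotaD add0n find_cat size_iota.
rewrite -[has _ _]negbK -all_predC /= subSn//= fm addn0 ifN//.
rewrite negbK; apply/allP => i; rewrite mem_iota add0n /= negbK => im.
by rewrite km.
Qed.

End DerivativeOnInterval.

(** Dividing out the full power of ['X - c%:P] lowers the degree by the multiplicity of [c] and
    leaves the multiplicities at the other points unchanged. *)
Lemma sum_mup_le (F : fieldType) (p : {poly F}) (s : seq F) : p != 0 ->
  uniq s -> (\sum_(c <- s) mup c p <= (size p).-1)%N.
Proof.
elim: s p => [|c s IH] p p0 /=; first by rewrite big_nil.
move=> /andP[cs us]; rewrite big_cons.
have [m [q]] := multiplicity_XsubC p c; rewrite p0 /= => qc pE.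
have q0 : q != 0 by apply: contraNneq p0 => q0; rewrite pE q0 mul0r.
have Xm0 : ('X - c%:P) ^+ m != 0 by rewrite expf_neq0// polyXsubC_eq0.
rewrite pE mupMr// mup_XsubCX eqxx size_mul// size_exp_XsubC addnS /=.
rewrite addnC (polySpred q0) addSn /= leq_add2r.
apply: leq_trans (IH q q0 us); rewrite leq_eqVlt; apply/orP; left; apply/eqP.
apply: eq_big_seq => d ds; apply: mupMl.
rewrite /root horner_exp !hornerE expf_neq0// subr_eq0.
by apply: contraNneq cs => <-.
Qed.

(** * The space of exponential polynomials is an extended Chebyshev space *)

Section ExponentialPolynomials.
Context {R : realType}.
Implicit Types (n k m : nat) (x c : R) (f : R -> R) (p q : {poly R}).

Definition euler n p : {poly R} := n%:R^-1 *: ('X * p^`()).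

Definition exp_poly n p x : R := p.[expR (x / n%:R)].

Lemma is_derive_expR_div n x :
  is_derive x 1 (fun y : R => expR (y / n%:R)) (n%:R^-1 * expR (x / n%:R)).
Proof.
have h : is_derive x 1 (fun y : R => n%:R^-1 *: y) (n%:R^-1 *: (1 : R)).
  exact: is_deriveZ.
have -> : (fun y : R => expR (y / n%:R)) = expR \o (fun y => n%:R^-1 *: y).
  by apply/funext => y /=; rewrite mulrC.
apply: (is_derive_eq (is_derive1_comp (is_derive_expR _) h)).
by rewrite /GRing.scale /= mulr1 mulrC ![_ / n%:R]mulrC.
Qed.

Lemma is_derive_exp_poly n p x :
  is_derive x 1 (exp_poly n p) (exp_poly n (euler n p) x).
Proof.
have h := is_derive_expR_div n x.
have -> : exp_poly n p = horner p \o (fun y => expR (y / n%:R)) by [].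
apply: (is_derive_eq (is_derive1_comp (is_derive_poly p _) h)).
by rewrite /exp_poly /euler hornerZ hornerM hornerX; ring.
Qed.

Lemma continuous_exp_poly n p : continuous (exp_poly n p).
Proof.
move=> x; apply/differentiable_continuous/derivable1_diffP.
exact: (@ex_derive _ _ _ _ _ _ _ (is_derive_exp_poly n p x)).
Qed.

Lemma nderiv_in_exp_poly n p f k : {in `[0, 1], f =1 exp_poly n p} ->
  {in `[0, 1], nderiv_in 0 1 k f =1 exp_poly n (iter k (euler n) p)}.
Proof.
move=> fp; apply: (@nderiv_inE _ _ _ _ (fun k => exp_poly n (iter k (euler n) p))) => //.
by move=> i x _; exact: is_derive_exp_poly.
Qed.

(** One application of [euler] lowers the multiplicity of [c] by exactly one: the new cofactor [q']
    takes at [c] the value [c * (m + 1) * q(c) / n], where [c != 0] keeps the factor ['X] from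
    vanishing. *)
Lemma iter_euler_XsubC n p q c m : (0 < n)%N -> c != 0 ->
  p = q * ('X - c%:P) ^+ m ->
  (forall k, (k < m)%N -> (iter k (euler n) p).[c] = 0) /\
  (q.[c] != 0 -> (iter m (euler n) p).[c] != 0).
Proof.
move=> n0 c0; elim: m p q => [|m IH] p q pE.
  by split=> //; rewrite pE expr0 mulr1.
pose q' := n%:R^-1 *: ('X * (q^`() * ('X - c%:P) + q *+ m.+1)).
have pE' : euler n p = q' * ('X - c%:P) ^+ m.
  rewrite /euler /q' pE derivM deriv_exp derivXsubC mul1r /= exprS -scalerAl.
  by congr (_ *: _); ring.
have [IH1 IH2] := IH _ _ pE'; split.
  case=> [_|k km]; first by rewrite /= pE !hornerE subrr exprS !(mul0r, mulr0).
  by rewrite iterSr; exact: IH1.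
move=> qc; rewrite iterSr; apply: IH2.
rewrite /q' !(hornerE, hornerMn) subrr mulr0 add0r.
by rewrite !mulf_neq0// ?invr_eq0 ?pnatr_eq0 -?lt0n// -mulr_natr mulf_neq0// pnatr_eq0.
Qed.

Lemma zero_order_exp_poly n p q f x m : (0 < n)%N -> (m <= n)%N ->
  x \in `[0, 1] -> {in `[0, 1], f =1 exp_poly n p} ->
  p = q * ('X - (expR (x / n%:R))%:P) ^+ m -> ~~ root q (expR (x / n%:R)) ->
  zero_order 0 1 n f x = m.
Proof.
move=> n0 mn x01 fp pE qx.
have c0 : expR (x / n%:R) != 0 by rewrite expR_eq0.
have [h1 h2] := iter_euler_XsubC n0 c0 pE.
apply: zero_orderE => // [k km|]; rewrite (nderiv_in_exp_poly _ fp)//.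
  exact: h1.
exact: h2.
Qed.

Lemma exp_spaceP n f : exp_space n f <->
  exists2 p : {poly R}, (size p <= n.+1)%N & {in `[0, 1], f =1 exp_poly n p}.
Proof.
have E x j : expR (j%:R * x / n%:R) = expR (x / n%:R) ^+ j.
  by rewrite -mulrA expRM_natl.
split=> [[c fc]|[p sp fp]].
  exists (\poly_(i < n.+1) c (inord i)) => [|x x01]; first exact: size_poly.
  rewrite fc// /exp_poly horner_poly; apply: eq_bigr => i _.
  by rewrite inord_val E.
exists (fun i => p`_i) => x x01.
rewrite fp// /exp_poly (horner_coef_wide _ sp); apply: eq_bigr => i _.
by rewrite E.
Qed.

Lemma divn_itv01 n k : (0 < n)%N -> (k <= n)%N -> k%:R / n%:R \in `[0 : R, 1].
Proof.
move=> n0 kn; rewrite in_itv /= divr_ge0//= ler_pdivrMr ?ltr0n// mul1r.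
by rewrite ler_nat.
Qed.

Lemma exp_poly_eq0 n p : (0 < n)%N -> (size p <= n.+1)%N ->
  {in `[0, 1], forall x, exp_poly n p x = 0} -> p = 0.
Proof.
(* The [n + 1] points [k / n] of the interval yield [n + 1] distinct roots, one more than the degree
   allows. *)
move=> n0 sp p0; pose s := [seq expR ((k%:R / n%:R : R) / n%:R) | k <- iota 0 n.+1].
apply: (@roots_geq_poly_eq0 _ p s); last by rewrite size_map size_iota.
  apply/allP => c /mapP[k]; rewrite mem_iota /= add0n ltnS => kn ->.
  by apply/eqP; exact/p0/divn_itv01.
rewrite map_inj_uniq ?iota_uniq// => i j /expR_inj.
have nz : (n%:R : R) != 0 by rewrite pnatr_eq0 -lt0n.
by move=> /(mulIf (invr_neq0 nz)) /(mulIf (invr_neq0 nz)) /eqP; rewrite eqr_nat => /eqP.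
Qed.

Lemma exp_space_Cnab n : exp_space n `<=` Cnab (0 : R) 1 n.
Proof.
move=> f /exp_spaceP[p _ fp]; split=> k kn.
  move=> x x01; apply/cvg_ex; exists (exp_poly n (euler n (iter k (euler n) p)) x).
  apply: (cvg_diff_quot (nderiv_in_exp_poly k fp)) => //.
  exact: is_derive_exp_poly.
apply: (@subspace_eq_continuous _ _ _ (exp_poly n (iter k (euler n) p))).
  by move=> x; rewrite inE => x01; apply/esym/nderiv_in_exp_poly.
exact/continuous_subspaceT/continuous_exp_poly.
Qed.

(** Since [x |-> e^(x/n)] is injective, distinct zeros give distinct roots, and their multiplicities
    add up to at most the degree. *)
Lemma ext_chebyshev_exp_space n : (0 < n)%N ->
  ext_chebyshev (0 : R) 1 n (exp_space n).
Proof.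
move=> n0; split => //.
- eexists; split; last reflexivity.
  move=> c hc i.
  have p0 : \poly_(i < n.+1) c (inord i) = 0.
    apply: (exp_poly_eq0 n0 (size_poly _ _)) => x x01.
    rewrite -(hc x x01) /exp_poly horner_poly.
    by apply: eq_bigr => j _; rewrite inord_val -mulrA expRM_natl.
  have := coef_poly n.+1 (fun i => c (inord i)) i.
  by rewrite p0 coef0 ltn_ord inord_val.
- exact: exp_space_Cnab.
- move=> f /exp_spaceP[p sp fp] [y y01 fy] s us s01.
  have p0 : p != 0.
    by apply: contra_neq fy => p0; rewrite fp// /exp_poly p0 horner0.
  have zE x : x \in s -> zero_order 0 1 n f x = mup (expR (x / n%:R)) p.
    move=> xs; have [m [q]] := multiplicity_XsubC p (expR (x / n%:R)).
    rewrite p0 /= => qx pE.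
    have q0 : q != 0 by apply: contraNneq p0 => q0; rewrite pE q0 mul0r.
    rewrite (zero_order_exp_poly n0 _ _ fp pE qx) ?s01//.
      by rewrite pE mupMr// mup_XsubCX eqxx.
    (* [zero_order] saturates at [n + 1], so the multiplicity has to be bounded by [n] before the
       two can be identified. *)
    rewrite -ltnS (leq_trans _ sp)// pE size_mul//; last first.
      by rewrite expf_neq0// polyXsubC_eq0.
    by rewrite size_exp_XsubC addnS /= -[leqLHS]add1n leq_add2r size_poly_gt0.
  rewrite (eq_big_seq _ zE) -(big_map (fun x => expR (x / n%:R)) xpredT (fun c => mup c p)).
  apply: leq_trans (sum_mup_le p0 _) _.
    rewrite map_inj_uniq// => u v /expR_inj /mulIf; apply.
    by rewrite invr_eq0 pnatr_eq0 -lt0n.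
  by rewrite -ltnS prednK ?size_poly_gt0.
Qed.

End ExponentialPolynomials.

(** * The operator, its Bernstein basis, its fixed functions, and the failure of ordinary
    convexity *)

Section ExponentialBernstein.
Context {R : realType}.
Implicit Types (n k m : nat) (x : R) (f : R -> R).

Lemma expR_inv_gt1 n : (0 < n)%N -> 1 < expR (1 / n%:R) :> R.
Proof. by move=> n0; rewrite expR_gt1 divr_gt0// ltr0n. Qed.

Lemma varphiE n x : varphi n x = (expR (x / n%:R) - 1) / (expR (1 / n%:R) - 1).
Proof. by []. Qed.

Lemma varphi_ge0_le1 n x : (0 < n)%N -> x \in `[0, 1] -> 0 <= varphi n x <= 1.
Proof.
move=> n0; rewrite in_itv /= => /andP[x0 x1].
have q1 := expR_inv_gt1 n0.
rewrite /varphi ler_pdivlMr ?subr_gt0// ler_pdivrMr ?subr_gt0// mul0r.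
rewrite subr_ge0 -[leLHS]expR0 ler_expR divr_ge0//=.
by rewrite [leRHS]mul1r lerD2r ler_expR ler_pM2r// invr_gt0 ltr0n.
Qed.

Lemma expR_varphi n x : (0 < n)%N ->
  1 - varphi n x + expR (1 / n%:R) * varphi n x = expR (x / n%:R).
Proof.
move=> n0; rewrite /varphi; field.
by rewrite subr_eq0 gt_eqF// expR_inv_gt1.
Qed.

Lemma exp_bernsteinE n f x : exp_bernstein n f x =
  casteljau n (fun k => f (k%:R / n%:R)) (varphi n x).
Proof. exact: casteljauE. Qed.

Lemma expR_node n k : expR (k%:R / n%:R) = expR (1 / n%:R) ^+ k :> R.
Proof. by rewrite -expRM_natl mul1r. Qed.

Lemma exp_bernstein_cst n a x : exp_bernstein n (fun=> a) x = a.
Proof. by rewrite exp_bernsteinE casteljau_cst. Qed.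

Lemma exp_bernstein_expR n x : (0 < n)%N -> exp_bernstein n expR x = expR x.
Proof.
move=> n0; rewrite exp_bernsteinE.
under [LHS]eq_casteljau do rewrite expR_node.
rewrite casteljau_exp expR_varphi// ?expR_eq0// -expRM_natl.
by rewrite mulrC divfK// pnatr_eq0 -lt0n.
Qed.

(** [varphi] and, next, [1 - varphi] as polynomials in [s = e^(x/n)], with the linear factor
    isolated: the roots [s = 1] and [s = e^(1/n)] correspond to the end points 0 and 1. *)
Definition varphi_poly n : {poly R} :=
  ('X - 1%:P) * ((expR (1 / n%:R) - 1)^-1)%:P.

Definition varphi_copoly n : {poly R} :=
  ('X - (expR (1 / n%:R))%:P) * (- (expR (1 / n%:R) - 1)^-1)%:P.

Definition bernstein_poly n k : {poly R} :=
  varphi_poly n ^+ k * varphi_copoly n ^+ (n - k).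

Lemma exp_poly_bernstein n k x : (0 < n)%N ->
  exp_poly n (bernstein_poly n k) x = varphi n x ^+ k * (1 - varphi n x) ^+ (n - k).
Proof.
move=> n0; rewrite /exp_poly /bernstein_poly /varphi_poly /varphi_copoly.
rewrite hornerM !horner_exp !hornerM !hornerXsubC !hornerC.
congr (_ * _ ^+ _); rewrite /varphi; field.
by rewrite subr_eq0 gt_eqF// expR_inv_gt1.
Qed.

Lemma size_bernstein_poly n k : (k <= n)%N -> (size (bernstein_poly n k) <= n.+1)%N.
Proof.
have sz c a m : (size ((('X - c%:P) * a%:P) ^+ m : {poly R}) <= m.+1)%N.
  apply: leq_trans (size_poly_exp_leq _ _) _; rewrite ltnS -{2}[m]mul1n leq_mul2r.
  apply/orP; right; rewrite mulrC mul_polyC.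
  by rewrite -subn1 leq_subLR (leq_trans (size_scale_leq _ _))// size_XsubC.
move=> kn; apply: leq_trans (size_polyMleq _ _) _.
rewrite -ltnS -[X in (_ < X)%N]/n.+2.
have := leq_add (sz 1 ((expR (1 / n%:R) - 1)^-1) k)
  (sz (expR (1 / n%:R)) (- (expR (1 / n%:R) - 1)^-1) (n - k)%N).
rewrite addSnnS addnS addnS subnKC//.
by case: (_ + _)%N.
Qed.

Lemma exp_space_exp_bernstein n f : (0 < n)%N -> exp_space n (exp_bernstein n f).
Proof.
move=> n0; apply/exp_spaceP.
exists (\sum_(k < n.+1) (f (k%:R / n%:R) * 'C(n, k)%:R) *: bernstein_poly n k).
  apply: (leq_trans (size_sum _ _ _)); apply/bigmax_leqP => k _.
  by rewrite (leq_trans (size_scale_leq _ _))// size_bernstein_poly// -ltnS.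
move=> x _; rewrite /exp_poly horner_sum; apply: eq_bigr => k _.
by rewrite hornerZ -/(exp_poly n _ x) exp_poly_bernstein// mulrA.
Qed.

Lemma nonneg_bernstein_basis_varphi n : (0 < n)%N ->
  nonneg_bernstein_basis (0 : R) 1 (exp_space n)
    (fun (k : 'I_n.+1) x => varphi n x ^+ k * (1 - varphi n x) ^+ (n - k)).
Proof.
move=> n0 k; have kn : (k <= n)%N by rewrite -ltnS.
have q1 : expR (1 / n%:R) - 1 != 0 :> R by rewrite subr_eq0 gt_eqF// expR_inv_gt1.
have bE : {in `[0, 1], (fun x : R => varphi n x ^+ k * (1 - varphi n x) ^+ (n - k))
    =1 exp_poly n (bernstein_poly n k)}.
  by move=> x _; rewrite exp_poly_bernstein.
split.
- by apply/exp_spaceP; exists (bernstein_poly n k) => //; exact: size_bernstein_poly.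
- move=> x /(varphi_ge0_le1 n0) /andP[p0 p1].
  by rewrite mulr_ge0// exprn_ge0// subr_ge0.
- pose q := ((expR (1 / n%:R) - 1)^-1)%:P ^+ k * varphi_copoly n ^+ (n - k).
  apply: (@zero_order_exp_poly _ _ _ q _ _ _ n0 kn _ bE); rewrite ?in_itv/= ?lexx ?ler01//.
  + by rewrite mul0r expR0 /bernstein_poly exprMn /q; ring.
  + rewrite mul0r expR0 /root /q /varphi_copoly hornerM !horner_exp hornerM.
    rewrite hornerXsubC !hornerC mulf_neq0// expf_neq0 ?invr_eq0//.
    by rewrite mulf_neq0// ?oppr_eq0 ?invr_eq0// -opprB oppr_eq0.
- pose q := varphi_poly n ^+ k * (- (expR (1 / n%:R) - 1)^-1)%:P ^+ (n - k).
  apply: (@zero_order_exp_poly _ _ _ q _ _ _ n0 (leq_subr _ _) _ bE); rewrite ?in_itv/= ?lexx ?ler01//.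
  + by rewrite /bernstein_poly [varphi_copoly n ^+ _]exprMn /q; ring.
  + rewrite /root /q /varphi_poly hornerM !horner_exp hornerM.
    rewrite hornerXsubC !hornerC mulf_neq0// expf_neq0 ?oppr_eq0 ?invr_eq0//.
    by rewrite mulf_neq0// ?invr_eq0.
Qed.

Lemma gen_bernstein_operator_exp_bernstein n : (0 < n)%N ->
  gen_bernstein_operator 0 1 (exp_space n) (fun=> 1) expR
    (fun k : 'I_n.+1 => k%:R / n%:R : R) (exp_bernstein n).
Proof.
move=> n0; have nz : (n%:R : R) != 0 by rewrite pnatr_eq0 -lt0n.
have B1 : exp_bernstein n (fun=> 1) = (fun=> 1) :> (R -> R).
  by apply/funext => x; exact: exp_bernstein_cst.
have BE : exp_bernstein n expR = expR :> (R -> R).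
  by apply/funext => x; exact: exp_bernstein_expR.
split.
- exact: ext_chebyshev_exp_space.
- split => //.
  + by rewrite -B1; exact: exp_space_exp_bernstein.
  + by rewrite -BE; exact: exp_space_exp_bernstein.
  + by move=> x y _ _ xy; rewrite !divr1 ltr_expR.
- split; first by move=> k; apply: divn_itv01 => //; rewrite -ltnS.
    by rewrite mul0r.
  by rewrite divff.
- exists (fun k => 'C(n, k)%:R).
  exists (fun k x => varphi n x ^+ k * (1 - varphi n x) ^+ (n - k)); split.
  + by move=> k; rewrite ltr0n bin_gt0 -ltnS.
  + exact: nonneg_bernstein_basis_varphi.
  + move=> f _; split; first exact: exp_space_exp_bernstein.
    by move=> x _; apply: eq_bigr => k _; rewrite !mulrA.
- by rewrite B1 BE.
Qed.

Lemma exp_bernstein_id n x : (0 < n)%N -> exp_bernstein n id x = varphi n x.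
Proof.
move=> n0; have nz : (n%:R : R) != 0 by rewrite pnatr_eq0 -lt0n.
rewrite exp_bernsteinE.
rewrite (@eq_casteljau _ _ _ (fun k => n%:R^-1 * k%:R + 0 * 0)).
  by rewrite (casteljau_linear _ _ (fun=> 0)) casteljau_id; field.
by move=> k _; ring.
Qed.

Lemma exp_bernstein_opp_not_convex n : (0 < n)%N ->
  [/\ Cab 0 1 (-%R : R -> R), convex_on 0 1 (-%R : R -> R) &
      ~ convex_on 0 1 (exp_bernstein n (-%R : R -> R))].
Proof.
move=> n0; split.
- by apply: continuous_subspaceT => x; exact: opp_continuous.
- move=> x y xI yI xy c0 c1 hx hy z _.
  have c1E : c1 = -1 by nra.
  by subst c1; lra.
- have BN x : exp_bernstein n -%R x = - varphi n x.
    rewrite -exp_bernstein_id// !exp_bernsteinE.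
    rewrite -[RHS]mulN1r -[RHS]addr0 -{1}(mul0r (casteljau n (fun=> 0) (varphi n x))).
    rewrite -casteljau_linear; apply: eq_casteljau => k _; ring.
  have q1 := expR_inv_gt1 n0.
  have v0 : varphi n 0 = 0 :> R by rewrite /varphi mul0r expR0 subrr mul0r.
  have v1 : varphi n 1 = 1 :> R by rewrite /varphi divff// subr_eq0 gt_eqF.
  have i0 : (0 : R) \in `[0, 1] by rewrite in_itv /= lexx ler01.
  have i1 : (1 : R) \in `[0, 1] by rewrite in_itv /= lexx ler01.
  have ih : (1 / 2 : R) \in `[0, 1] by rewrite in_itv /=; lra.
  (* The chord of [- varphi n] over the whole interval is [- x]; it is compared with the function at
     1/2. *)
  move=> /(_ 0 1 i0 i1 ltr01 0 (-1)); rewrite !BN v0 v1.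
  rewrite !(mul0r, add0r, mulr0, oppr0, mulr1) => /(_ erefl erefl (1 / 2) ih).
  rewrite BN.
  apply/negP; rewrite -ltNge /varphi.
  (* With [p = e^(1/(2n)) > 1], the value of [varphi] at 1/2 is
     [(p - 1) / (p^2 - 1) = 1 / (p + 1) < 1/2]. *)
  have -> : 1 / n%:R = 2 * (1 / 2 / n%:R) :> R by field; rewrite pnatr_eq0 -lt0n.
  rewrite (expRM_natl 2).
  set p := expR _.
  have p1 : 1 < p by rewrite expR_gt1 !divr_gt0// ltr0n.
  have -> : (p - 1) / (p ^+ 2 - 1) = 1 / (p + 1).
    by field; apply/andP; split; apply/lt0r_neq0; nra.
  rewrite add0r mulN1r ltrN2 ltr_pdivrMr; nra.
Qed.

End ExponentialBernstein.

(** * Preservation of convexity with respect to [(1, e^x)] *)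

Section ConvexityPreservation.
Context {R : realType}.
Implicit Types (n k m : nat) (x : R) (f : R -> R).

(* [rho] is the derivative of [phi] with respect to [expR]. *)
Lemma gconvex_expR (phi rho : R -> R) :
  (forall x, is_derive x 1 phi (expR x * rho x)) ->
  {in `[0, 1] &, {homo rho : x y / x <= y}} ->
  gconvex 0 1 (fun=> 1) expR phi.
Proof.
move=> dphi hrho x y xI yI xy c0 c1 hx hy z; rewrite in_itv /= => /andP[xz zy].
pose D t := phi t - (c0 * 1 + c1 * expR t).
have dD (t : R) : is_derive t 1 D (expR t * (rho t - c1)).
  have h1 := dphi t; rewrite /D.
  have h2 : is_derive t 1 (fun t => c0 * 1 + c1 * expR t) (c1 * expR t).
    apply: is_derive_eq.
    rewrite /GRing.scale /=; ring.
  by apply: is_derive_eq; ring.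
have cD a b : {within `[a, b], continuous D}.
  apply: continuous_subspaceT => t.
  by apply/differentiable_continuous/derivable1_diffP; exact: ex_derive.
rewrite -subr_le0 -/(D z); apply: contraT; rewrite -ltNge => Dz.
have Dx : D x = 0 by rewrite /D hx subrr.
have Dy : D y = 0 by rewrite /D hy subrr.
have xz' : x < z by rewrite lt_neqAle xz andbT; apply: contraTneq Dz => <-; rewrite Dx ltxx.
have zy' : z < y by rewrite lt_neqAle zy andbT; apply: contraTneq Dz => ->; rewrite Dy ltxx.
(* [D] vanishes at [x] and [y] and is positive at [z], so the mean value theorem on both sides gives
   [s < t] with [rho s > c1 > rho t], against monotonicity. *)
have [s sI] := MVT xz' (fun t _ => dD t) (cD _ _).
have [t tI] := MVT zy' (fun t _ => dD t) (cD _ _).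
move: sI tI xI yI; rewrite !in_itv /= => /andP[xs sz] /andP[zt ty] /andP[x0 x1] /andP[y0 y1].
rewrite Dx Dy => ht hs.
have st : rho s <= rho t by apply: hrho; rewrite ?in_itv /=; lra.
have es := expR_gt0 s; have et := expR_gt0 t.
have : 0 < rho s - c1.
  rewrite -(pmulr_rgt0 _ es) -(pmulr_lgt0 (x := z - x)) ?subr_gt0//; lra.
have : rho t - c1 < 0.
  rewrite -(pmulr_rlt0 _ et) -(pmulr_llt0 (x := y - z)) ?subr_gt0//; lra.
lra.
Qed.

(** The interpolant at the outer nodes, where [expR] is [q^k] and [q^(k+2)], takes the value
    [u + (v - u) / (q + 1)] at the middle node. Bounding [f] there by it and clearing the
    denominator gives the claim. *)
Lemma gconvex_node_slopes n f k : (0 < n)%N -> (k.+1 < n)%N ->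
  gconvex 0 1 (fun=> 1) expR f ->
  expR (1 / n%:R) * (f (k.+1%:R / n%:R) - f (k%:R / n%:R)) <=
  f (k.+2%:R / n%:R) - f (k.+1%:R / n%:R).
Proof.
move=> n0 kn cf; have q1 := expR_inv_gt1 (R := R) n0.
have ni : 0 < (n%:R : R)^-1 by rewrite invr_gt0 ltr0n.
have lt01 : k%:R / n%:R < k.+1%:R / n%:R :> R by rewrite ltr_pM2r// ltr_nat.
have lt12 : k.+1%:R / n%:R < k.+2%:R / n%:R :> R by rewrite ltr_pM2r// ltr_nat.
have Ik : (k%:R / n%:R : R) \in `[0, 1] by apply: divn_itv01 => //; exact: ltnW (ltnW kn).
have Ik2 : (k.+2%:R / n%:R : R) \in `[0, 1] by exact: divn_itv01.
set u := f (k%:R / n%:R); set v := f (k.+2%:R / n%:R).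
set q := expR (1 / n%:R) in q1 *.
have qk : 0 < q ^+ k by rewrite exprn_gt0// (lt_trans ltr01).
pose c1 := (v - u) / (q ^+ k * (q ^+ 2 - 1)).
have := cf _ _ Ik Ik2 (lt_trans lt01 lt12) (u - c1 * q ^+ k) c1.
rewrite !expR_node -/q mulr1 subrK => /(_ erefl).
have q2 : q ^+ 2 - 1 != 0 by apply/lt0r_neq0; nra.
have -> : u - c1 * q ^+ k + c1 * q ^+ k.+2 = v.
  by rewrite /c1 !exprS; field; rewrite q2 /= lt0r_neq0.
move=> /(_ erefl (k.+1%:R / n%:R)); rewrite in_itv /= (ltW lt01) (ltW lt12) => /(_ isT).
rewrite expR_node -/q; set w := f _.
have -> : u - c1 * q ^+ k + c1 * q ^+ k.+1 = u + (v - u) / (q + 1).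
  rewrite /c1 [q ^+ k.+1]exprS; field; rewrite q2 !lt0r_neq0//; lra.
rewrite -lerBlDl ler_pdivlMr; last lra.
by nra.
Qed.

Lemma gconvex_exp_bernstein n f : (0 < n)%N ->
  gconvex 0 1 (fun=> 1) expR f -> gconvex 0 1 (fun=> 1) expR (exp_bernstein n f).
Proof.
move=> n0 cf; have q1 := expR_inv_gt1 (R := R) n0.
have nz : (n%:R : R) != 0 by rewrite pnatr_eq0 -lt0n.
set q := expR (1 / n%:R) in q1 *; have q0 : q != 0 by rewrite expR_eq0.
(* Dividing the differences by [q^k] prepares for [casteljau_tilt], whose new parameter is [tau],
   the weight being [e^(x/n)] by [expR_varphi]. *)
pose r k := (f (k.+1%:R / n%:R) - f (k%:R / n%:R)) / q ^+ k.
pose tau x : R := q * varphi n x / expR (x / n%:R).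
apply: (@gconvex_expR _ (fun x => (q - 1)^-1 * casteljau n.-1 r (tau x))).
  move=> x.
  have dvarphi : is_derive x 1 (varphi n : R -> R)
      ((q - 1)^-1 * (n%:R^-1 * expR (x / n%:R))).
    have h := is_derive_expR_div n x.
    rewrite -[varphi n]/(fun y : R => (expR (y / n%:R) - 1) * (q - 1)^-1).
    apply: is_derive_eq; rewrite /GRing.scale /=; ring.
  have -> : exp_bernstein n f =
      casteljau n (fun k => f (k%:R / n%:R)) \o varphi n.
    by apply/funext => y; exact: exp_bernsteinE.
  apply: (is_derive_eq (is_derive1_comp (is_derive_casteljau _ _ _) dvarphi)).
  have -> : casteljau n.-1 (fun k => f (k.+1%:R / n%:R) - f (k%:R / n%:R)) (varphi n x) =
      casteljau n.-1 (fun k => r k * q ^+ k) (varphi n x).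
    by apply: eq_casteljau => k _; rewrite /r divfK// expf_neq0.
  (* The tilt contributes [e^((n-1)x/n)] and the derivative of [varphi] contributes [e^(x/n)];
     together they form the [e^x] required by [gconvex_expR]. *)
  rewrite casteljau_tilt expR_varphi ?expR_eq0// -/(tau x).
  have -> : expR x = expR (x / n%:R) ^+ n.-1 * expR (x / n%:R).
    by rewrite -exprSr prednK// -expRM_natl mulrC divfK.
  by field; rewrite nz subr_eq0 gt_eqF.
have qq : 0 < (q - 1)^-1 by rewrite invr_gt0 subr_gt0.
(* In this form [tau] is visibly increasing, from 0 at 0 to 1 at 1. *)
have tauE x : tau x = (q - q / expR (x / n%:R)) / (q - 1).
  rewrite /tau varphiE -/q; field.
  by rewrite expR_eq0 subr_eq0 gt_eqF.
have hq : 0 < q by exact: expR_gt0.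
have htau : {in `[0, 1] &, {homo tau : x y / x <= y}}.
  move=> x y _ _ xy; rewrite !tauE ler_pM2r// lerD2l lerN2 ler_pM2l//.
  rewrite lef_pV2 ?posrE ?expR_gt0// ler_expR ler_pM2r// invr_gt0 ltr0n//.
have I0 : (0 : R) \in `[0, 1] by rewrite in_itv /= lexx ler01.
have I1 : (1 : R) \in `[0, 1] by rewrite in_itv /= lexx ler01.
move=> x y xI yI xy; rewrite ler_pM2l//.
move: (xI) (yI); rewrite !in_itv /= => /andP[x0 x1] /andP[y0 y1].
apply: casteljau_nondecreasing.
- rewrite (le_trans _ (htau 0 x I0 xI x0))// tauE mul0r expR0 divr1 subrr mul0r//.
- exact: htau.
- rewrite (le_trans (htau y 1 yI I1 y1))// tauE -/q divff// divff// subr_eq0 gt_eqF//.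
- move=> k km; rewrite /r exprS invfM mulrA ler_pM2r ?invr_gt0 ?exprn_gt0//.
  rewrite ler_pdivlMr// mulrC; apply: gconvex_node_slopes => //.
  by rewrite -ltnS prednK in km.
Qed.

End ConvexityPreservation.

(** * Uniform convergence to the identity *)

Section Convergence.
Context {R : realType}.
Implicit Types (n k m : nat) (x : R) (f : R -> R).

Lemma within_itv_uniformly_continuous a b f :
  {within `[a, b], continuous f} -> forall e, 0 < e -> exists2 d, 0 < d &
    {in `[a, b] &, forall x y, `|x - y| < d -> `|f x - f y| < e}.
Proof.
move=> /subspace_continuousP cf e e0.
have e2 : 0 < e / 2 by rewrite divr_gt0.
pose P (d x : R) := x \in `[a, b] ->
  {in `[a, b], forall y, `|x - y| < d -> `|f x - f y| < e}.
(* Heine's theorem: compactness in near-covering form, with the moduli filtered by [0^'+], turns a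
   local choice of modulus into one valid for all [x]. *)
have /compact_near_coveringP/(_ R 0^'+ P) := @segment_compact R a b.
case.
- move=> x xab; have /cvgrPdist_lt/(_ _ e2)[d /= d0 hd] := cf x xab.
  (* Halving the radius keeps both [z] and any [y] close to [z] within [d] of [x]. *)
  exists (ball x (d / 2), [set t | t < d / 2]) => /=.
    split; first by apply: nbhsx_ballx; rewrite divr_gt0.
    by apply: nbhs_right_lt; rewrite divr_gt0.
  case=> z t /= [+ td] zab y yab zyt; rewrite /ball/= => xz.
  have h1 : `|f x - f z| < e / 2 by apply: hd => //=; rewrite /ball_ /=; lra.
  have h2 : `|f x - f y| < e / 2.
    by apply: hd => //=; rewrite /ball_ /= -(subrKA z) (le_lt_trans (ler_normD _ _))//; lra.
  rewrite -(subrKA (f x)) (le_lt_trans (ler_normD _ _))// [`|f z - _|]distrC; lra.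
- move=> d /= d0 hd; exists (d / 2); first by rewrite divr_gt0.
  move=> x y xab yab xy; apply: (hd (d / 2)) => //=.
  + by rewrite /ball_ /= sub0r normrN gtr0_norm ?divr_gt0//; lra.
  + by rewrite divr_gt0.
Qed.

Lemma within_itv_bounded a b f : {within `[a, b], continuous f} ->
  exists2 M, 0 < M & {in `[a, b], forall x, `|f x| <= M}.
Proof.
move=> cf; have /compact_bounded[M [_ hM]] := continuous_compact cf (@segment_compact R a b).
exists (`|M| + 1); first by rewrite ltr_wpDl.
move=> x xab; apply: (hM (`|M| + 1)); last by exists x.
by rewrite (le_lt_trans (ler_norm M))// ltrDl.
Qed.

(** With [h = 1/n], convexity of the exponential gives [varphi <= x]; the lower bound combines
    [e^(xh) - 1 >= xh] with [q - 1 <= h q]. *)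
Lemma varphi_dist n x : (0 < n)%N -> x \in `[0, 1] -> `|varphi n x - x| <= n%:R^-1.
Proof.
move=> n0 xI; have /andP[p0 p1] := varphi_ge0_le1 n0 xI.
move: xI; rewrite in_itv /= => /andP[x0 x1].
have q1 := expR_inv_gt1 (R := R) n0.
have ni : 0 < (n%:R : R)^-1 by rewrite invr_gt0 ltr0n.
move: q1 p0 p1; rewrite /varphi mul1r; set h := n%:R^-1 in ni *; set q := expR h => q1 p0 p1.
have d0 : 0 < q - 1 by rewrite subr_gt0.
have expR_le (u : R) : expR u - 1 <= u * expR u.
  have := expR_ge1Dx (- u); have := expRxMexpNx_1 u; have := expR_gt0 u; nra.
have hx : h * x <= expR (x * h) - 1.
  by have := expR_ge1Dx (x * h); lra.
have hq : q - 1 <= h * q by exact: expR_le.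
have hq' : h <= q - 1 by have := expR_ge1Dx h; rewrite -/q; lra.
(* The chord inequality comes from the tangent bounds for [e^(-xh)] and [e^(h-xh)], weighted by
   [1 - x] and [x]: the weighted bounds sum to exactly 1. *)
have hu : expR (x * h) <= 1 - x + x * q.
  have h0 : (1 - x) + x * q > 0 by nra.
  have e1 : 1 - x * h <= expR (- (x * h)) by have := expR_ge1Dx (- (x * h)); lra.
  have e2 : 1 + (h - x * h) <= expR (h - x * h) by exact: expR_ge1Dx.
  have e3 : q = expR (h - x * h) * expR (x * h) by rewrite -expRD subrK.
  have e4 : expR (- (x * h)) * expR (x * h) = 1 by rewrite mulrC expRxMexpNx_1.
  have e0 := expR_gt0 (x * h).
  rewrite -[leLHS]mul1r.
  have : 1 <= (1 - x) * expR (- (x * h)) + x * expR (h - x * h) by nra.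
  by rewrite -(ler_pM2r e0); rewrite mulrDl -2!mulrA e4 -e3 mulr1.
have hd : 0 <= h * (q - 1) by rewrite mulr_ge0// ltW.
rewrite ler_norml; apply/andP; split.
  suff : x - h <= (expR (x * h) - 1) / (q - 1) by lra.
  rewrite ler_pdivlMr//.
  have : 0 <= (1 - x) * (h * (q - 1)) by rewrite mulr_ge0// subr_ge0.
  have : 0 <= x * (h * q - (q - 1)) by rewrite mulr_ge0// subr_ge0.
  lra.
rewrite lerBlDr ler_pdivrMr//; lra.
Qed.

(** With [p = varphi n x] the left side is the variance [p (1 - p) / n] plus the squared bias
    [(p - x)^2], each at most [1 / n]. *)
Lemma exp_bernstein_variance n x : (0 < n)%N -> x \in `[0, 1] ->
  casteljau n (fun k => (k%:R / n%:R - x) ^+ 2) (varphi n x) <= 2 / n%:R.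
Proof.
move=> n0 xI; have nz : (n%:R : R) != 0 by rewrite pnatr_eq0 -lt0n.
rewrite (@eq_casteljau _ _ _ (fun k => n%:R^-2 * k%:R ^+ 2 +
  1 * ((- 2 * x / n%:R) * k%:R + 1 * x ^+ 2))); last first.
  by move=> k _; field.
rewrite casteljau_linear (casteljau_linear _ _ (fun=> x ^+ 2)).
rewrite casteljau_sqr casteljau_id casteljau_cst.
have /andP[p0 p1] := varphi_ge0_le1 n0 xI; have := varphi_dist n0 xI.
set p := varphi n x in p0 p1 *; rewrite ler_norml => /andP[d1 d2].
have -> : n%:R ^- 2 * (n%:R * p * (1 - p) + (n%:R * p) ^+ 2) +
  1 * (- 2 * x / n%:R * (n%:R * p) + 1 * x ^+ 2) =
  p * (1 - p) / n%:R + (p - x) ^+ 2 by field.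
have ni : 0 < (n%:R : R)^-1 by rewrite invr_gt0 ltr0n.
have ni1 : (n%:R : R)^-1 <= 1 by rewrite invf_le1 ?ltr0n// ler1n.
set h := n%:R^-1 in d1 d2 ni ni1 *.
have : (p - x) ^+ 2 <= h by nra.
have : p * (1 - p) * h <= h by nra.
lra.
Qed.

(* Chebyshev's argument: a node farther than [d] from [x] contributes at most
   [2 M <= 2 M (k / n - x)^2 / d^2]. *)
Lemma exp_bernstein_dist n f x M d e : (0 < n)%N -> x \in `[0, 1] ->
  0 < d -> 0 < e -> {in `[0, 1], forall x, `|f x| <= M} ->
  {in `[0, 1] &, forall x y, `|x - y| < d -> `|f x - f y| < e} ->
  `|exp_bernstein n f x - f x| <= e + 4 * M / d ^+ 2 / n%:R.
Proof.
move=> n0 xI d0 e0 fM fd; have pI := varphi_ge0_le1 n0 xI.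
have M0 : 0 <= M by rewrite (le_trans _ (fM x xI)).
have c0 : 0 <= 2 * M / d ^+ 2 by rewrite divr_ge0 ?exprn_ge0 ?mulr_ge0// ltW.
pose g k : R := (k%:R / n%:R - x) ^+ 2.
have key k : (k <= n)%N ->
    `|f (k%:R / n%:R) - f x| <= 1 * e + 2 * M / d ^+ 2 * g k.
  move=> kn; have kI := @divn_itv01 R _ _ n0 kn; rewrite mul1r.
  have g0 : 0 <= g k by rewrite sqr_ge0.
  have [lt|le] := ltP `|k%:R / n%:R - x| d.
    by rewrite (le_trans (ltW (fd _ _ kI xI lt)))// lerDl mulr_ge0.
  have : d ^+ 2 <= g k by rewrite /g -[leRHS](real_normK (num_real _)) lerXn2r// nnegrE// ltW.
  move=> dg; have : 2 * M <= 2 * M / d ^+ 2 * g k.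
    rewrite mulrAC ler_pdivlMr ?exprn_gt0// ler_wpM2l// mulr_ge0//.
  have := fM _ kI; have := fM _ xI; have := ler_normB (f (k%:R / n%:R)) (f x).
  lra.
(* The signs [s = -1] and [s = 1] give the two majorants of [f] at the nodes, below and above;
   constants pass through unchanged. *)
have gE (s : R) : casteljau n (fun k => s * (1 * e + 2 * M / d ^+ 2 * g k) + 1 * f x) (varphi n x)
    = s * (e + 2 * M / d ^+ 2 * casteljau n g (varphi n x)) + f x.
  rewrite (casteljau_linear _ _ (fun=> f x)) (casteljau_linear _ (fun=> e)).
  by rewrite !casteljau_cst !mul1r.
have gv : 2 * M / d ^+ 2 * casteljau n g (varphi n x) <= 4 * M / d ^+ 2 / n%:R.
  have -> : 4 * M / d ^+ 2 / n%:R = 2 * M / d ^+ 2 * (2 / n%:R).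
    by field; rewrite pnatr_eq0 -lt0n n0 lt0r_neq0.
  by rewrite ler_wpM2l ?exp_bernstein_variance.
rewrite exp_bernsteinE ler_norml; apply/andP; split.
  apply: (@le_trans _ _ (-1 * (e + 2 * M / d ^+ 2 * casteljau n g (varphi n x)))); first lra.
  rewrite lerBrDr -gE; apply: ler_casteljau => // k kn.
  have := key k kn; rewrite ler_norml => /andP[]; lra.
apply: (@le_trans _ _ (1 * (e + 2 * M / d ^+ 2 * casteljau n g (varphi n x)))); last lra.
rewrite lerBlDr -gE; apply: ler_casteljau => // k kn.
have := key k kn; rewrite ler_norml => /andP[]; lra.
Qed.

Lemma cvg_uniform_exp_bernstein f : Cab 0 1 f ->
  {uniform `[0, 1], (fun n => exp_bernstein n f) @ \oo --> f}.
Proof.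
move=> cf; have [M M0 fM] := within_itv_bounded cf.
move=> P /uniform_nbhs[E []]; rewrite -entourage_ballE => -[e /= e0 eE] EP.
have e2 : 0 < e / 2 by rewrite divr_gt0.
have [d d0 fd] := within_itv_uniformly_continuous cf e2.
pose C := 4 * M / d ^+ 2.
have C0 : 0 < C by rewrite !mulr_gt0// invr_gt0 exprn_gt0.
have := @near_infty_natSinv_lt R (PosNum (divr_gt0 e2 C0)).
(* Starting at [N.+1] discards the index 0, where the estimates do not apply, and matches the
   reciprocals of successors in [hN]. *)
case=> N _ hN; exists N.+1 => // -[//|n] /= nN; apply: EP => x /= xI.
apply: eE; rewrite /ball /= distrC.
apply: le_lt_trans (exp_bernstein_dist _ xI d0 e2 fM fd) _ => //.
have := hN n nN; rewrite /= ltr_pdivlMr// [_ * C]mulrC; rewrite -[4 * M / _]/C; by rewrite -(ltrD2l (e / 2)) -splitr.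
Qed.

End Convergence.

Theorem mainTheorem2 (R : realType) :
  [/\ forall n : nat, (0 < n)%N ->
        let t := fun k : 'I_n.+1 => k%:R / n%:R : R in
        (forall i j : 'I_n.+1, (i < j)%N -> t i < t j) /\
        gen_bernstein_operator 0 1 (exp_space n) (fun=> 1) expR t
          (exp_bernstein n),
      forall f : R -> R, Cab 0 1 f ->
        {uniform `[0, 1], (fun n => exp_bernstein n f) @ \oo --> f},
      forall n : nat, (0 < n)%N -> forall f : R -> R, Cab 0 1 f ->
        gconvex 0 1 (fun=> 1) expR f ->
        gconvex 0 1 (fun=> 1) expR (exp_bernstein n f)
    & forall n : nat, (0 < n)%N -> exists f : R -> R,
        [/\ Cab 0 1 f, convex_on 0 1 f & ~ convex_on 0 1 (exp_bernstein n f)]].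
Proof.
split.
- move=> n n0 t; split; last exact: gen_bernstein_operator_exp_bernstein.
  by move=> i j ij; rewrite /t ltr_pM2r ?invr_gt0 ?ltr0n// ltr_nat.
- exact: cvg_uniform_exp_bernstein.
- by move=> n n0 f _; exact: gconvex_exp_bernstein.
- by move=> n n0; exists -%R; exact: exp_bernstein_opp_not_convex.
Qed.
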